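(* Let $n\ge 1$ be an integer, let $T=H_{2n}([n(2n-1)])$, and let $P_\ast^{(n)}$ be the $2n^2\times 2n^2$ array consisting of $n\times n$ blocks of size $2n\times 2n$, whose $i$-th diagonal block ($i\in[n]$) is $\pi_{AD,2}^{i}(T)$ and whose off-diagonal block in position $(i,j)$, $i\ne j$, is $\tilde I_{2n}(t_{i,j})$, where the $t_{i,j}$ are distinct integers not occurring in $T$. Then there exists a set $\mathcal{P}$ of $2n$ $(2n^2,2n^2,0,4n^4)$ $1$-PDAs that are Blackburn-compatible w.r.t. $P_\ast^{(n)}$ and such that $L_{\mathcal{P},P_\ast^{(n)}}(I_{2n})$ is a $2n$-regular $(4n^3,\;4n^3,\;4n^3-8n^2+7n-2,\;2n^2(8n^2-7n+2))$ PDA.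
   Context: Notation: $[n]=\{0,1,\dots,n-1\}$; rows and columns are indexed from $0$. For positive integers $K,f$, a nonnegative integer $Z$ and a finite set $\mathcal{S}$ of integers, a $(K,f,Z,\mathcal{S})$ placement delivery array (PDA) is an $f\times K$ array $P=[p_{j,k}]$ with entries in $\mathcal{S}\cup\{\ast\}$ such that: (C1) $\ast$ appears exactly $Z$ times in each column; (C2) each $s\in\mathcal{S}$ occurs at least once; (C3, Blackburn property) if two distinct cells $(j_1,k_1)$, $(j_2,k_2)$ contain the same integer then $p_{j_1,k_2}=p_{j_2,k_1}=\ast$. It is $g$-regular (a $g$-PDA) if each integer of $\mathcal{S}$ occurs exactly $g$ times. A number $S$ in place of the set means the integer set has $S$ elements. Blackburn compatibility: for arrays $P_0,P_1,P_\ast$ of the same size, $P_0$ and $P_1$ are Blackburn-compatible w.r.t. $P_\ast$ if, whenever $p^{(0)}_{i_1j_1}=p^{(1)}_{i_2j_2}\neq\ast$, we have $p^{(\ast)}_{i_1j_2}=p^{(\ast)}_{i_2j_1}=\ast$. A family is Blackburn-compatible w.r.t. $P_\ast$ if any two different members of the family are. $\tilde I_m(t)$ is the $m\times m$ array with integer $t$ on the anti-diagonal and $\ast$ elsewhere. $H_m(\mathcal{S})$ with $|\mathcal{S}|=m(m-1)/2$ is the symmetric $m\times m$ array with $\ast$ on the diagonal and the distinct integers of $\mathcal{S}$ filled row-wise below the diagonal (reflected across the diagonal above it). For an $m\times m$ array $P$, $\pi_{AD,1}(P)$ equals $P$ except that each anti-diagonal entry at $(i,j)$ moves to $(i-1,j+1)$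 mod $m$. For a $2m\times 2m$ array $P=\begin{pmatrix}P_{11}&P_{12}\\P_{21}&P_{22}\end{pmatrix}$ with $m\times m$ blocks, $\pi_{AD,2}(P)=\begin{pmatrix}P_{11}&\pi_{AD,1}(P_{12})\\ \pi_{AD,1}^{-1}(P_{21})&P_{22}\end{pmatrix}$; powers denote iteration. Lifting of $I_{g}$: for $\mathcal{P}=\{P_0,\dots,P_{g-1}\}$ and $P_\ast$ of the same size, $L_{\mathcal{P},P_\ast}(I_g)$ is the $g\times g$ block array whose $i$-th diagonal block is $P_i$ and whose off-diagonal blocks are copies of $P_\ast$ with integers relabelled so that the integer sets of these copies are disjoint from each other and from the integers of $P_0,\dots,P_{g-1}$. *)

(* Defs.v *)
From mathcomp Require Import all_boot all_order all_algebra.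
From mathcomp Require Import finmap mxtens.

Set Implicit Arguments.
Unset Strict Implicit.
Unset Printing Implicit Defensive.

(* None stands for the symbol "*"; an f x K array has f rows and K columns. *)
Notation "''Arr_' ( f , K )" := ('M[option int]_(f, K))
  (at level 8, format "''Arr_' ( f ,  K )") : type_scope.

Definition occurs f K (s : int) (P : 'Arr_(f, K)) : bool :=
  [exists j, exists k, P j k == Some s].

(* The array dimensions r, c are tied to the parameters f, K by equations, so
   that the parameters can be given in closed form without casting P. *)
Definition is_pda (K f Z : nat) (S : {fset int}) r c (P : 'Arr_(r, c)) : Prop :=
  [/\ [/\ 0 < K, 0 < f, r = f & c = K],
      forall j k s, P j k = Some s -> s \in S,
      (* (C1) *) forall k, #|[set j | P j k == None]| = Z,
      (* (C2) *) forall s, s \in S -> occurs s P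
    & (* (C3) *) forall j1 k1 j2 k2 s, (j1, k1) != (j2, k2) ->
        P j1 k1 = Some s -> P j2 k2 = Some s ->
        P j1 k2 = None /\ P j2 k1 = None].

Definition regular g (S : {fset int}) r c (P : 'Arr_(r, c)) : Prop :=
  forall s, s \in S -> #|[set jk | P jk.1 jk.2 == Some s]| = g.

(* g-regular PDA, with only the number N of integers specified *)
Definition is_gpda (g K f Z N : nat) r c (P : 'Arr_(r, c)) : Prop :=
  exists S : {fset int}, [/\ #|` S| = N, is_pda K f Z S P & regular g S P].

Definition blackburn_compatible f K (P0 P1 Pstar : 'Arr_(f, K)) : Prop :=
  forall i1 j1 i2 j2, P0 i1 j1 = P1 i2 j2 -> P0 i1 j1 <> None ->
    Pstar i1 j2 = None /\ Pstar i2 j1 = None.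

Definition family_compatible g f K (P : 'I_g -> 'Arr_(f, K))
    (Pstar : 'Arr_(f, K)) : Prop :=
  forall a b, P a != P b -> blackburn_compatible (P a) (P b) Pstar.

Definition antidiag_array m (t : int) : 'Arr_(m, m) :=
  \matrix_(i, j) if i + j == m.-1 then Some t else None.

(* s lists the m(m-1)/2 integers in filling order; below the diagonal, row i
   is preceded by 0 + 1 + ... + (i-1) = 'C(i, 2) cells. *)
Definition H_array m (s : seq int) : 'Arr_(m, m) :=
  \matrix_(i, j) if i == j then None
                 else Some (nth 0%R s ('C(maxn i j, 2) + minn i j)).

(* The entry of piAD1 P at the anti-diagonal cell (i, j) comes from the cell
   (i + 1, j - 1) mod m. *)
Definition piAD1 m (P : 'Arr_(m, m)) : 'Arr_(m, m) :=
  \matrix_(i, j) if i + j == m.-1 then P (ordS i) (ord_pred j) else P i j.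

Definition piAD1_inv m (P : 'Arr_(m, m)) : 'Arr_(m, m) :=
  \matrix_(i, j) if i + j == m.-1 then P (ord_pred i) (ordS j) else P i j.

Definition piAD2 m (P : 'Arr_(m + m, m + m)) : 'Arr_(m + m, m + m) :=
  block_mx (ulsubmx P) (piAD1 (ursubmx P))
           (piAD1_inv (dlsubmx P)) (drsubmx P).

(* mxtens_unindex k = (k %/ r, k %% r): block number and position in block. *)
Definition block_array g r c (B : 'I_g -> 'I_g -> 'Arr_(r, c)) :
    'Arr_(g * r, g * c) :=
  \matrix_(i, j) let: (a, i') := mxtens_unindex i in
                 let: (b, j') := mxtens_unindex j in B a b i' j'.

Definition relabel f K (rho : int -> int) (P : 'Arr_(f, K)) : 'Arr_(f, K) :=
  map_mx (omap rho) P.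

(* rho a b relabels the copy of Pstar in the off-diagonal block (a, b). *)
Definition admissible_relabelling g f K (P : 'I_g -> 'Arr_(f, K))
    (Pstar : 'Arr_(f, K)) (rho : 'I_g -> 'I_g -> int -> int) : Prop :=
  [/\ forall a b, a != b ->
        {in [pred s | occurs s Pstar] &, injective (rho a b)},
      forall a b a' b' s, a != b -> a' != b' -> (a, b) != (a', b') ->
        ~~ (occurs s (relabel (rho a b) Pstar)
            && occurs s (relabel (rho a' b') Pstar))
    & forall a b c s, a != b ->
        ~~ (occurs s (relabel (rho a b) Pstar) && occurs s (P c))].

(* lifting of I_g, for a given choice of relabelling *)
Definition lifting_I g f K (P : 'I_g -> 'Arr_(f, K)) (Pstar : 'Arr_(f, K))
    (rho : 'I_g -> 'I_g -> int -> int) : 'Arr_(g * f, g * K) :=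
  block_array (fun a b => if a == b then P a else relabel (rho a b) Pstar).

(* 2n is written n + n, so that piAD2 sees the four n x n blocks. *)
Definition T_array n : 'Arr_(n + n, n + n) :=
  H_array (n + n) [seq Posz i | i <- iota 0 (n * (2 * n - 1))].

Definition Pstar_array n (t : 'I_n -> 'I_n -> int) :
    'Arr_(n * (n + n), n * (n + n)) :=
  block_array (fun i j => if i == j then iter i (@piAD2 n) (T_array n)
                          else antidiag_array (n + n) (t i j)).

(* Main.v *)
(**
  Any g-regular PDA Q admits a Blackburn-compatible family of g 1-PDAs: let
  sigma_a shift cyclically by a the g cells holding each given integer of Q and
  fix the starred cells, and let P_a carry in cell x the label of sigma_a(x).
  If P_a and P_b (a <> b) agree at x and y, then either x = y is a star of Q, or
  x and y are distinct cells holding the same integer of Q; in both cases the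
  mixed cells are stars.  It remains to see that P_* is a 2n-regular PDA: the
  rotation turns the antidiagonal of T by a different angle in each diagonal
  block, so an antidiagonal integer of T never sits in the same row and column of
  two diagonal blocks, where it would face the antidiagonals off the diagonal.
*)
Require Import Defs.
From mathcomp Require Import all_boot all_order all_algebra.
From mathcomp Require Import finmap mxtens zify ring.

Set Implicit Arguments.
Unset Strict Implicit.
Unset Printing Implicit Defensive.

(** * Counting cells in regular PDAs *)

Definition cells f K (s : int) (P : 'Arr_(f, K)) : {set 'I_f * 'I_K} :=
  [set jk | P jk.1 jk.2 == Some s].

(* The number of integers is left out: double counting the cells that are not
   stars determines it from g, K, f and Z. *)
Definition gpda_axioms g Z f K (P : 'Arr_(f, K)) : Prop :=
  [/\ forall k, #|[set j | P j k == None]| = Z,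
      forall j1 k1 j2 k2 s, (j1, k1) != (j2, k2) ->
        P j1 k1 = Some s -> P j2 k2 = Some s ->
        P j1 k2 = None /\ P j2 k1 = None
    & forall s, occurs s P -> #|cells s P| = g].

Lemma occursP f K s (P : 'Arr_(f, K)) :
  reflect (exists x : 'I_f * 'I_K, P x.1 x.2 = Some s) (occurs s P).
Proof.
apply: (iffP existsP) => [[j /existsP[k /eqP e]]|[[j k] e]]; first by exists (j, k).
by exists j; apply/existsP; exists k; apply/eqP.
Qed.

Lemma occurs_at f K s (P : 'Arr_(f, K)) j k : P j k = Some s -> occurs s P.
Proof. by move=> e; apply/occursP; exists (j, k). Qed.

Lemma cells_notin f K s (P : 'Arr_(f, K)) : ~~ occurs s P -> #|cells s P| = 0.
Proof.
move=> sP; apply: eq_card0 => -[j k]; rewrite inE /=.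
by apply: contraNF sP => /eqP/occurs_at.
Qed.

Lemma card_nonstar f K Z (P : 'Arr_(f, K)) :
  (forall k, #|[set j | P j k == None]| = Z) ->
  #|[set x : 'I_f * 'I_K | P x.1 x.2 != None]| + K * Z = f * K.
Proof.
move=> C1.
suff <-: #|[set x : 'I_f * 'I_K | P x.1 x.2 == None]| = K * Z.
  have -> : f * K = #|{: 'I_f * 'I_K}| by rewrite card_prod !card_ord.
  rewrite addnC -(cardsC [set x | P x.1 x.2 == None]); congr (_ + _).
  by apply: eq_card => x; rewrite !inE.
rewrite cardsE -sum1_card big_mkcond.
rewrite -(pair_bigA _ (fun j k => if P j k == None then 1 else 0)) exchange_big /=.
rewrite (eq_bigr (fun=> Z)) => [|k _]; first by rewrite sum_nat_const card_ord.
by rewrite -big_mkcond /= sum1_card -cardsE C1.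
Qed.

Lemma gpda_axioms_is_gpda g Z N f K (P : 'Arr_(f, K)) :
    0 < g -> 0 < K -> 0 < f -> g * N + K * Z = f * K ->
  gpda_axioms g Z P -> is_gpda g K f Z N P.
Proof.
move=> g0 K0 f0 eN [C1 C3 reg].
(* Taking exactly the integers that occur makes (C2) hold by construction. *)
pose S := [fset s in pmap (fun x => P x.1 x.2) (enum {: 'I_f * 'I_K})]%fset.
have memS s : (s \in S) = occurs s P.
  rewrite in_fset mem_pmap; apply/mapP/occursP => [[x _ ->]|[x e]]; exists x => //.
  by rewrite mem_enum.
exists S; split; last by move=> s; rewrite memS => /reg.
(* Double count of the pairs formed by a cell and its integer; comparison with [eN] then allows
   cancelling $g>0$. *)
- have e : #|[set x : 'I_f * 'I_K | P x.1 x.2 != None]| = g * #|` S|.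
    transitivity (\sum_(s <- S) #|cells s P|); last first.
      rewrite big_seq (eq_bigr (fun=> g)) -?big_seq => [|s]; last by rewrite memS => /reg.
      by rewrite big_const_seq count_predT iter_addn_0 mulnC.
    transitivity (\sum_(s <- S) \sum_(x : 'I_f * 'I_K) (P x.1 x.2 == Some s)).
      rewrite exchange_big cardsE -sum1_card big_mkcond /=; apply: eq_bigr => x _.
      rewrite unfold_in; case e: (P _ _) => [s|] /=; last by rewrite big1.
      rewrite (bigD1_seq s) ?fset_uniq ?memS ?(occurs_at e) //=.
      rewrite eqxx big1 // => s' ne; case: eqP => // -[es].
      by rewrite es eqxx in ne.
    by apply: eq_bigr => s _; rewrite cardsE -sum1_card [RHS]big_mkcond.
  have := card_nonstar C1; rewrite e -eN => /addIn/eqP.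
  by rewrite eqn_pmul2l // => /eqP.
- split=> //.
  + by move=> j k s /occurs_at; rewrite memS.
  + by move=> s; rewrite memS.
Qed.

(** * Cyclic shifts inside fibres, and the compatible family of 1-PDAs *)

(** The list [e] depends on [x] only through [p x], so all cells of a fibre move along one common
    cycle. Stars are left fixed, because two distinct stars carry no condition on their mixed
    cells. *)
Definition class_shift (X : finType) (Y : eqType) (p : X -> option Y) (a : nat)
    (x : X) : X :=
  let e := enum [set y | p y == p x] in
  if p x is Some _ then nth x e ((index x e + a) %% size e) else x.

Lemma mem_class (X : finType) (Y : eqType) (p : X -> option Y) x y :
  (y \in enum [set z | p z == p x]) = (p y == p x).
Proof. by rewrite mem_enum inE. Qed.

Lemma class_size_gt0 (X : finType) (Y : eqType) (p : X -> option Y) x :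
  0 < size (enum [set y | p y == p x]).
Proof. by case: (enum _) (mem_class p x x) => //; rewrite eqxx. Qed.

Lemma class_shift_class (X : finType) (Y : eqType) (p : X -> option Y) a x :
  p (class_shift p a x) = p x.
Proof.
rewrite /class_shift; case e: (p x) => [s|] //; rewrite -e; apply/eqP.
by rewrite -mem_class mem_nth // ltn_mod class_size_gt0.
Qed.

(** Shifts preserve fibres, so cells with equal images share one list [e], where adding [a] to the
    index modulo the length is injective. *)
Lemma class_shift_inj (X : finType) (Y : eqType) (p : X -> option Y) a :
  injective (class_shift p a).
Proof.
move=> x y exy; have pxy : p x = p y by rewrite -(class_shift_class p a x) exy class_shift_class.
move: exy; rewrite /class_shift pxy; case e: (p y) => [s|] //; rewrite -e.
set c := enum _.
have c0 : 0 < size c := class_size_gt0 p y.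
have cx : x \in c by rewrite mem_class pxy.
have cy : y \in c by rewrite mem_class.
(* The two [nth] have different defaults, [x] and [y]; since the indices are in range, the defaults
   can be made to agree. *)
rewrite (set_nth_default y) ?ltn_mod // => /eqP.
rewrite nth_uniq ?enum_uniq ?ltn_mod // eqn_modDr !modn_small ?index_mem // => /eqP ei.
by rewrite -(nth_index y cx) ei nth_index.
Qed.

Lemma class_shift_eq (X : finType) (Y : eqType) (p : X -> option Y) a b x s :
  p x = Some s ->
  a < #|[set y | p y == Some s]| -> b < #|[set y | p y == Some s]| ->
  class_shift p a x = class_shift p b x -> a = b.
Proof.
move=> px; rewrite /class_shift cardE px /= -px; set c := enum _ => ac bc.
have c0 : 0 < size c := class_size_gt0 p x.
move=> /eqP; rewrite nth_uniq ?enum_uniq ?ltn_mod // eqn_modDl.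
by rewrite !modn_small // => /eqP.
Qed.

(** An integer in [Q] makes the members distinct: on stars alone all shifts are the identity. The
    last two conclusions serve the lifting: a shared integer set gives each integer one cell in
    every diagonal block, and nonnegative labels leave the negative integers free for the copies of
    [Q]. *)
Lemma nonneg_label_family g Z f K (Q : 'Arr_(f, K)) :
    gpda_axioms g Z Q -> (exists s, occurs s Q) ->
  exists P : 'I_g -> 'Arr_(f, K),
    [/\ injective P,
        forall a, gpda_axioms 1 0 (P a),
        family_compatible P Q,
        forall a b s, occurs s (P a) -> occurs s (P b)
      & forall a s, occurs s (P a) -> exists k : nat, s = k].
Proof.
move=> [_ C3 reg] [s0 occ0].
pose p (x : 'I_f * 'I_K) := Q x.1 x.2.
have shiftN0 (a b : 'I_g) x s : p x = Some s ->
    class_shift p a x = class_shift p b x -> a = b.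
  move=> px e; have cg : #|[set y | p y == Some s]| = g by apply/reg/(occurs_at px).
  by apply/val_inj/(class_shift_eq px _ _ e); rewrite cg.
(* The label is the rank of the shifted cell among all cells, so equal labels mean equal shifted
   cells. *)
pose P (a : 'I_g) : 'Arr_(f, K) :=
  (\matrix_(j, k) Some (Posz (enum_rank (class_shift p a (j, k)))))%R.
have PE a x : P a x.1 x.2 = Some (Posz (enum_rank (class_shift p a x))).
  by rewrite mxE -surjective_pairing.
have Peq a b x y : P a x.1 x.2 = P b y.1 y.2 -> class_shift p a x = class_shift p b y.
  by rewrite !PE => -[/ord_inj/enum_rank_inj].
exists P; split.
- move=> a b eab; have /occursP[x px] := occ0; apply: (shiftN0 _ _ x s0 px).
  by apply: Peq; rewrite eab.
- move=> a; split.
  + by move=> k; apply: eq_card0 => j; rewrite inE (PE a (j, k)).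
  + move=> j1 k1 j2 k2 s /eqP ne e1 e2; case: ne.
    by apply/(@class_shift_inj _ _ p a)/Peq; rewrite e1 e2.
  + move=> s /occursP[x px]; apply/eqP/cards1P; exists x; apply/setP => y.
    rewrite !inE -px; apply/eqP/eqP => [e|-> //].
    by apply/(@class_shift_inj _ _ p a)/Peq.
- move=> a b neab i1 j1 i2 j2 e _.
  have /Peq es := (e : P a (i1, j1).1 (i1, j1).2 = P b (i2, j2).1 (i2, j2).2).
  have pe : p (i1, j1) = p (i2, j2).
    by rewrite -(class_shift_class p a) es class_shift_class.
  case: (eqVneq (i1, j1) (i2, j2)) => [[ei ej]|ne].
    subst i2 j2; case px : (p (i1, j1)) => [s|]; last by split.
    by case/eqP: neab; congr P; apply: (shiftN0 _ _ _ _ px es).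
  case px: (p (i1, j1)) => [s|]; first exact: C3 ne px (etrans (esym pe) px).
  (* Both cells are stars, hence fixed by the shifts, so they would coincide, against [ne]. *)
  move: es; rewrite /class_shift -pe px => es.
  by rewrite es eqxx in ne.
- move=> a b s /occursP[x]; rewrite PE => -[<-].
  have [y ey] : exists y, class_shift p b y = class_shift p a x.
    have [h _ hK] := injF_bij (@class_shift_inj _ _ p b).
    by exists (h (class_shift p a x)).
  by apply/occursP; exists y; rewrite PE ey.
- by move=> a s /occursP[x]; rewrite PE => -[<-]; exists (enum_rank (class_shift p a x)).
Qed.

(** * Block arrays, relabelling and the lifting of $I_g$ *)

Lemma block_arrayE g r c (B : 'I_g -> 'I_g -> 'Arr_(r, c)) a b i j :
  block_array B (mxtens_index (a, i)) (mxtens_index (b, j)) = B a b i j.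
Proof. by rewrite mxE !mxtens_indexK. Qed.

Lemma mxtens_index_bij m n : bijective (@mxtens_index m n).
Proof. exact: Bijective (@mxtens_indexK m n) (@mxtens_unindexK m n). Qed.

Lemma block_array_stars g r c (B : 'I_g -> 'I_g -> 'Arr_(r, c)) b j :
  #|[set x | block_array B x (mxtens_index (b, j)) == None]|
  = \sum_(a < g) #|[set i | B a b i j == None]|.
Proof.
rewrite cardsE -sum1_card big_mkcond.
rewrite (reindex (@mxtens_index g r)); last exact/onW_bij/mxtens_index_bij.
transitivity (\sum_(a < g) \sum_(i < r) (if B a b i j == None then 1 else 0)).
  by rewrite pair_bigA; apply: eq_bigr => -[a i] _; rewrite /= unfold_in block_arrayE.
by apply: eq_bigr => a _; rewrite cardsE -sum1_card [RHS]big_mkcond.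
Qed.

Lemma block_array_cells g r c (B : 'I_g -> 'I_g -> 'Arr_(r, c)) s :
  #|cells s (block_array B)| = \sum_(a < g) \sum_(b < g) #|cells s (B a b)|.
Proof.
rewrite cardsE -sum1_card big_mkcond.
rewrite -(pair_bigA _ (fun x y => if block_array B x y == Some s then 1 else 0)).
rewrite (reindex (@mxtens_index g r)) /=; last exact/onW_bij/mxtens_index_bij.
pose F (a : 'I_g) (i : 'I_r) := \sum_y
  (if block_array B (mxtens_index (a, i)) y == Some s then 1 else 0).
rewrite (eq_bigr (fun x => F x.1 x.2)) => [|[a i] _ //].
rewrite -pair_bigA; apply: eq_bigr => a _.
transitivity (\sum_(i < r) \sum_(b < g) \sum_(j < c) if B a b i j == Some s then 1 else 0).
  apply: eq_bigr => i _.
  rewrite /F (reindex (@mxtens_index g c)) /=; last exact/onW_bij/mxtens_index_bij.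
  by rewrite pair_bigA; apply: eq_bigr => -[b j] _; rewrite block_arrayE.
rewrite exchange_big; apply: eq_bigr => b _.
by rewrite pair_bigA /= -big_mkcond sum1_card -cardsE.
Qed.

Lemma block_array_occurs g r c (B : 'I_g -> 'I_g -> 'Arr_(r, c)) s :
  reflect (exists a b, occurs s (B a b)) (occurs s (block_array B)).
Proof.
apply: (iffP idP) => [/occursP[[x y] /=]|[a [b /occursP[[i j] e]]]].
  case: (mxtens_indexP x) => a i; case: (mxtens_indexP y) => b j.
  by rewrite block_arrayE => /occurs_at; exists a, b.
by apply/occursP; exists (mxtens_index (a, i), mxtens_index (b, j)); rewrite block_arrayE.
Qed.

Lemma relabel_star f K rho (P : 'Arr_(f, K)) j k :
  (relabel rho P j k == None) = (P j k == None).
Proof. by rewrite mxE; case: (P j k). Qed.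

Lemma relabel_eq f K rho (P : 'Arr_(f, K)) j k s :
  relabel rho P j k = Some s -> exists2 s', P j k = Some s' & rho s' = s.
Proof. by rewrite mxE; case: (P j k) => //= s' [<-]; exists s'. Qed.

Lemma relabel_cells f K rho (P : 'Arr_(f, K)) s :
    {in [pred s | occurs s P] &, injective rho} -> occurs s P ->
  cells (rho s) (relabel rho P) = cells s P.
Proof.
move=> inj occ; apply/setP => -[j k]; rewrite !inE mxE.
case e: (P j k) => [s'|] //=; apply/eqP/eqP => -[] => [es|-> //].
by congr Some; apply: inj; rewrite ?inE ?(occurs_at e).
Qed.

(** A column meets $g-1$ copies of [Q], with [Z] stars each, and one diagonal block without stars.
    Equal integers lie in one copy of [Q], in one diagonal block, or in two diagonal blocks; in the
    last case the mixed cells fall in copies of [Q], and compatibility makes them stars. An integer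
    occurs either once in each of the [g] diagonal blocks or [g] times in a single copy. *)
Lemma lifting_gpda g Z f K (P : 'I_g -> 'Arr_(f, K)) (Q : 'Arr_(f, K)) rho :
    gpda_axioms g Z Q -> injective P -> (forall a, gpda_axioms 1 0 (P a)) ->
    family_compatible P Q -> (forall a b s, occurs s (P a) -> occurs s (P b)) ->
    admissible_relabelling P Q rho ->
  gpda_axioms g (g.-1 * Z) (lifting_I P Q rho).
Proof.
move=> [QC1 QC3 Qreg] Pinj Ppda Pcomp Pocc [rho_inj rho_disj rho_P]; split.
- move=> y; case: (mxtens_indexP y) => b j.
  rewrite block_array_stars (bigD1 b) //= eqxx.
  have [-> _ _] := Ppda b; rewrite add0n (eq_bigr (fun=> Z)) => [|a /negPf ne].
    by rewrite sum_nat_const cardC1 card_ord.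
  rewrite ne -(QC1 j); apply: eq_card => i; rewrite !inE; exact: relabel_star.
- move=> x1 y1 x2 y2 s.
  case: (mxtens_indexP x1) => a1 i1; case: (mxtens_indexP y1) => b1 j1.
  case: (mxtens_indexP x2) => a2 i2; case: (mxtens_indexP y2) => b2 j2.
  rewrite !block_arrayE => ne.
  case: (eqVneq a1 b1) => [eab1|neab1]; case: (eqVneq a2 b2) => [eab2|neab2] e1 e2.
  + subst b1 b2; rewrite [a2 == _]eq_sym; case: (eqVneq a1 a2) => [ea|nea].
      subst a2; have [_ C3 _] := Ppda a1; apply: C3 e1 e2.
      by apply: contra ne => /eqP[-> ->].
    (* Compatibility concerns different arrays, not different indices; injectivity of [P] bridges
       the two. *)
    have neP : P a1 != P a2 by apply: contra nea => /eqP/Pinj ->.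
    have [] := Pcomp _ _ neP i1 j1 i2 j2; rewrite ?e1 ?e2 // => h1 h2.
    by split; apply/eqP; rewrite relabel_star ?h1 ?h2.
  + by have /negP[] := rho_P a2 b2 a1 s neab2; rewrite (occurs_at e1) (occurs_at e2).
  + by have /negP[] := rho_P a1 b1 a2 s neab1; rewrite (occurs_at e1) (occurs_at e2).
  + case: (eqVneq (a1, b1) (a2, b2)) => [[ea eb]|neab]; last first.
      have /negP[] := rho_disj _ _ _ _ s neab1 neab2 neab.
      by rewrite (occurs_at e1) (occurs_at e2).
    subst a2 b2; rewrite (negPf neab1).
    have [s1 Q1 r1] := relabel_eq e1; have [s2 Q2 r2] := relabel_eq e2.
    have es : s1 = s2.
      apply: (rho_inj _ _ neab1); rewrite ?inE ?(occurs_at Q1) ?(occurs_at Q2) //.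
      by rewrite r1 r2.
    subst s2; have [|h1 h2] := QC3 _ _ _ _ _ _ Q1 Q2.
      by apply: contra ne => /eqP[-> ->].
    by split; apply/eqP; rewrite relabel_star ?h1 ?h2.
- move=> s /block_array_occurs[a [b]]; rewrite block_array_cells.
  case: (eqVneq a b) => [_ occ|neab /[dup] occ /occursP[x /relabel_eq[s' Qs' rs']]].
    rewrite -[RHS]card_ord -sum1_card; apply: eq_bigr => c _.
    rewrite (bigD1 c) //= eqxx big1 => [|d ne].
      by rewrite addn0; have [_ _ reg] := Ppda c; apply/reg/(Pocc a).
    rewrite eq_sym in ne; rewrite (negPf ne) cells_notin //; apply/negP => occ'.
    by have /negP[] := rho_P c d a s ne; rewrite occ occ'.
  rewrite pair_bigA /= (bigD1 (a, b)) //= (negPf neab) big1 => [|[c d] ne /=].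
    rewrite addn0 -rs' relabel_cells; first exact/Qreg/(occurs_at Qs').
      exact: rho_inj.
    exact: occurs_at Qs'.
  case: (eqVneq c d) => [_|necd]; apply: cells_notin; apply/negP => occ'.
    by have /negP[] := rho_P a b c s neab; rewrite occ occ'.
  by have /negP[] := rho_disj c d a b s necd neab ne; rewrite occ occ'.
Qed.

(** Encoding the triple of block position and integer as a negative integer keeps the copies apart
    from each other and from the nonnegative labels of [P]. *)
Lemma admissible_relabelling_exists g f K (P : 'I_g -> 'Arr_(f, K)) (Q : 'Arr_(f, K)) :
  (forall a s, occurs s (P a) -> exists k : nat, s = k) ->
  exists rho, admissible_relabelling P Q rho.
Proof.
move=> nonneg; pose rho (a b : 'I_g) (s : int) := Negz (choice.pickle (a, b, s)).
have rho_eq a b s : occurs s (relabel (rho a b) Q) -> exists s', s = rho a b s'.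
  by move=> /occursP[x /relabel_eq[s' _ <-]]; exists s'.
have rho_inj a b a' b' s s' : rho a b s = rho a' b' s' -> (a, b, s) = (a', b', s').
  by move=> [] /(pcan_inj choice.pickleK).
exists rho; split.
- by move=> a b _ s s' _ _ /rho_inj[].
- move=> a b a' b' s _ _ ne; apply/negP => /andP[/rho_eq[s1 ->] /rho_eq[s2]].
  by move=> /rho_inj[ea eb _]; rewrite ea eb eqxx in ne.
- by move=> a b c s _; apply/negP => /andP[/rho_eq[s1 ->] /nonneg[]].
Qed.

(** * The triangular numbering and the array $T$ *)

(** The numbers of row [b] fill the interval from ['C(b, 2)] up to but excluding ['C(b.+1, 2)], and
    these intervals are disjoint. *)
Lemma bin2_add_inj a b a' b' : a < b -> a' < b' ->
  'C(b, 2) + a = 'C(b', 2) + a' -> a = a' /\ b = b'.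
Proof.
have mono x y z w : x < y -> y < w -> 'C(y, 2) + x < 'C(w, 2) + z.
  move=> xy yw; apply: leq_trans (leq_addr _ _).
  by apply: leq_trans (leq_bin2l 2 yw); rewrite binS bin1 ltn_add2l.
move=> ab ab' e; case: (ltngtP b b') => [lt|gt|eb].
- by have := mono a b a' b' ab lt; rewrite e ltnn.
- by have := mono a' b' a b ab' gt; rewrite e ltnn.
- by move: e; rewrite eb => /addnI.
Qed.

Lemma T_arrayE n (r c : 'I_(n + n)) :
  T_array n r c = if r == c then None
                  else Some (Posz ('C(maxn r c, 2) + minn r c)).
Proof.
rewrite mxE; case: eqVneq => // ne; congr Some.
have {}ne : minn r c < maxn r c by move: ne; rewrite -val_eqE /=; lia.
(* The index is within the list, so the default of [nth] is never returned and the entry equals its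
   index. *)
have lt : 'C(maxn r c, 2) + minn r c < n * (2 * n - 1).
  have -> : n * (2 * n - 1) = 'C(n + n, 2).
    by rewrite addnn -mul2n bin2 -mulnA [2 * (n * _)]mul2n doubleK subn1.
  apply: (@leq_trans 'C((maxn r c).+1, 2)); first by rewrite binS bin1 ltn_add2l.
  by apply: leq_bin2l; rewrite gtn_max !ltn_ord.
by rewrite (nth_map 0) ?size_iota // nth_iota.
Qed.

Lemma T_array_sym n (r c : 'I_(n + n)) : T_array n r c = T_array n c r.
Proof. by rewrite !T_arrayE eq_sym maxnC minnC. Qed.

Lemma T_array_star n (r c : 'I_(n + n)) : (T_array n r c == None) = (r == c).
Proof. by rewrite T_arrayE; case: (r == c). Qed.

Lemma T_array_inj n (x y : 'I_(n + n) * 'I_(n + n)) s :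
  T_array n x.1 x.2 = Some s -> T_array n y.1 y.2 = Some s ->
  y = x \/ y = (x.2, x.1).
Proof.
case: x y => [r c] [r' c'] /=; rewrite !T_arrayE.
case: eqVneq => // ne [<-]; case: eqVneq => // ne' [] /bin2_add_inj[].
- by move: ne'; rewrite -val_eqE /=; lia.
- by move: ne; rewrite -val_eqE /=; lia.
move=> emin emax.
have [[e1 e2]|[e1 e2]] : (val r' = r /\ val c' = c) \/ (val r' = c /\ val c' = r).
  by move: ne ne' emin emax; rewrite -!val_eqE /=; lia.
- by left; rewrite (val_inj e1) (val_inj e2).
- by right; rewrite (val_inj e1) (val_inj e2).
Qed.

Lemma T_array_cells n s : occurs s (T_array n) -> #|cells s (T_array n)| = 2.
Proof.
move=> /occursP[[r c] /= e].
have ne : (r, c) != (c, r).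
  by apply/eqP => -[erc _]; move: e; rewrite T_arrayE erc eqxx.
transitivity #|[set (r, c); (c, r)]|; last by rewrite cards2 ne.
apply: eq_card => y; rewrite !inE; apply/eqP/orP => [e'|].
  by have [->|->] := T_array_inj (x := (r, c)) e e'; [left | right].
by move=> -[] /eqP-> //=; rewrite T_array_sym.
Qed.

(** * Antidiagonals and the rotation of the two halves of the index set *)

Lemma antidiag_rev m (i j : 'I_m) : (i + j == m.-1) = (j == rev_ord i).
Proof. by rewrite -val_eqE /=; have := ltn_ord i; lia. Qed.

Lemma eq_rev_ord m (i j : 'I_m) : (j == rev_ord i) = (i == rev_ord j).
Proof. by rewrite -[j in LHS]rev_ordK (inj_eq rev_ord_inj) eq_sym. Qed.

Lemma rev_ord_double_neq n (r : 'I_(n + n)) : r != rev_ord r.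
Proof. by apply/eqP => /(congr1 val) /=; have := ltn_ord r; lia. Qed.

Lemma rev_lshift n (u : 'I_n) : rev_ord (lshift n u) = rshift n (rev_ord u).
Proof. by apply: val_inj => /=; have := ltn_ord u; lia. Qed.

Lemma rev_rshift n (u : 'I_n) : rev_ord (rshift n u) = lshift n (rev_ord u).
Proof. by rewrite -[u in LHS]rev_ordK -rev_lshift rev_ordK. Qed.

Lemma ord_pred_rev n (u : 'I_n) : ord_pred (rev_ord u) = rev_ord (ordS u).
Proof.
apply: val_inj => /=; have un := ltn_ord u.
case: (ltngtP u.+1 n) => [lt| |e]; last first.
- have -> : (n - u.+1 + n).-1 = n - 1 by lia.
  by rewrite e modnn subn1 modn_small // prednK //; lia.
- by lia.
- rewrite (modn_small lt); have -> : (n - u.+1 + n).-1 = n - u.+2 + n by lia.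
  by rewrite modnDr modn_small //; lia.
Qed.

Lemma ordS_rev n (u : 'I_n) : ordS (rev_ord u) = rev_ord (ord_pred u).
Proof. by apply: rev_ord_inj; rewrite -ord_pred_rev !rev_ordK. Qed.

Lemma val_iter_ordS n i (u : 'I_n) : val (iter i (@ordS n) u) = (u + i) %% n.
Proof.
elim: i => [|i IH]; first by rewrite addn0 modn_small.
by rewrite iterS /= IH -addn1 modnDml addn1 addnS.
Qed.

(** This is the index map by which [piAD2] reads an antidiagonal cell. The upper right block reads
    from $(i+1,j-1)$ and the lower left one, by the inverse, from $(i-1,j+1)$, so the same map
    serves rows and columns. *)
Definition half_rot n (r : 'I_(n + n)) : 'I_(n + n) :=
  match split r with
  | inl u => lshift n (ordS u)
  | inr v => rshift n (ord_pred v)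
  end.

Lemma half_rot_lshift n (u : 'I_n) : half_rot (lshift n u) = lshift n (ordS u).
Proof. by rewrite /half_rot (unsplitK (inl u)). Qed.

Lemma half_rot_rshift n (u : 'I_n) : half_rot (rshift n u) = rshift n (ord_pred u).
Proof. by rewrite /half_rot (unsplitK (inr u)). Qed.

(** Reversal exchanges the halves and turns a successor into a predecessor. Hence the rotation maps
    the antidiagonal to itself. *)
Lemma half_rot_rev n (r : 'I_(n + n)) : half_rot (rev_ord r) = rev_ord (half_rot r).
Proof.
case: (split_ordP r) => u ->.
  by rewrite rev_lshift half_rot_rshift half_rot_lshift rev_lshift ord_pred_rev.
by rewrite rev_rshift half_rot_rshift half_rot_lshift rev_rshift ordS_rev.
Qed.

Lemma half_rot_half n (r : 'I_(n + n)) : (half_rot r < n) = (r < n).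
Proof.
case: (split_ordP r) => u ->.
  by rewrite half_rot_lshift (valP (ordS u)).
by rewrite half_rot_rshift /= ltnNge leq_addr.
Qed.

Lemma half_rot_inj n : injective (@half_rot n).
Proof.
move=> r r' e; have := half_rot_half r; rewrite e half_rot_half; move: e.
case: (split_ordP r) => u ->; case: (split_ordP r') => u' ->;
  rewrite ?half_rot_lshift ?half_rot_rshift //.
- by move=> /lshift_inj/ordS_inj->.
- by move=> /rshift_inj/ord_pred_inj->.
Qed.

Lemma iter_half_rot_rev n i (r : 'I_(n + n)) :
  iter i (@half_rot n) (rev_ord r) = rev_ord (iter i (@half_rot n) r).
Proof. by elim: i => //= i ->; rewrite half_rot_rev. Qed.

Lemma iter_half_rot_inj n i : injective (iter i (@half_rot n)).
Proof. by elim: i => [|i IH] x y //= /half_rot_inj/IH. Qed.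

Lemma iter_half_rot_half n i (r : 'I_(n + n)) : (iter i (@half_rot n) r < n) = (r < n).
Proof. by elim: i => //= i <-; rewrite half_rot_half. Qed.

(** Rotation keeps each half, whereas reversal exchanges them. *)
Lemma iter_half_rot_neq_rev n i i' (r : 'I_(n + n)) :
  iter i (@half_rot n) r <> iter i' (@half_rot n) (rev_ord r).
Proof.
move=> e; have := iter_half_rot_half i r; rewrite e iter_half_rot_half /=.
by have := ltn_ord r; lia.
Qed.

(** On the first half the power [i] adds [i] modulo [n], which determines [i] below [n]; reversal
    carries this to the second half. *)
Lemma iter_half_rot_free n i i' (r : 'I_(n + n)) : i < n -> i' < n ->
  iter i (@half_rot n) r = iter i' (@half_rot n) r -> i = i'.
Proof.
move=> lti lti'.
have free_l (u : 'I_n) :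
    iter i (@half_rot n) (lshift n u) = iter i' (@half_rot n) (lshift n u) -> i = i'.
  have iterE k : iter k (@half_rot n) (lshift n u) = lshift n (iter k (@ordS n) u).
    by elim: k => //= k ->; rewrite half_rot_lshift.
  rewrite !iterE => /lshift_inj/(congr1 val); rewrite !val_iter_ordS => /eqP.
  by rewrite eqn_modDl !modn_small // => /eqP.
case: (split_ordP r) => u -> e; first exact: free_l e.
by apply: (free_l (rev_ord u)); rewrite -rev_rshift !iter_half_rot_rev e.
Qed.

(** * The rotated copies of $T$ *)

Lemma piAD2E n (P : 'Arr_(n + n, n + n)) r c :
  piAD2 P r c = if c == rev_ord r then P (half_rot r) (half_rot c) else P r c.
Proof.
have lr (u v : 'I_n) : (lshift n u == rshift n v) = false by rewrite eq_lrshift.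
have rl (u v : 'I_n) : (rshift n u == lshift n v) = false by rewrite eq_rlshift.
rewrite /piAD2; case: (split_ordP r) => u ->; case: (split_ordP c) => v ->.
- by rewrite block_mxEul rev_lshift lr !mxE.
- rewrite block_mxEur rev_lshift (inj_eq (@rshift_inj _ _)) !mxE antidiag_rev.
  by case: ifP => _; rewrite ?half_rot_lshift ?half_rot_rshift ?mxE.
- rewrite block_mxEdl rev_rshift (inj_eq (@lshift_inj _ _)) !mxE antidiag_rev.
  by case: ifP => _; rewrite ?half_rot_lshift ?half_rot_rshift ?mxE.
- by rewrite block_mxEdr rev_rshift rl !mxE.
Qed.

(** The permutation of cells through which the power [i] of [piAD2] reads its argument. Properties
    of $T$ pass to its rotated copies because this permutation respects the antidiagonal, the
    diagonal and transposition. *)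
Definition antidiag_rot n i (x : 'I_(n + n) * 'I_(n + n)) : 'I_(n + n) * 'I_(n + n) :=
  if x.2 == rev_ord x.1 then (iter i (@half_rot n) x.1, iter i (@half_rot n) x.2)
  else x.

Lemma iter_piAD2E n i (P : 'Arr_(n + n, n + n)) r c :
  iter i (@piAD2 n) P r c =
  P (antidiag_rot i (r, c)).1 (antidiag_rot i (r, c)).2.
Proof.
rewrite /antidiag_rot /=; elim: i r c => [|i IH] r c; first by rewrite if_same.
rewrite iterS piAD2E !IH -!iterSr; case: eqP => // ->.
by rewrite half_rot_rev eqxx.
Qed.

Lemma antidiag_rot_rev n i (x : 'I_(n + n) * 'I_(n + n)) :
  ((antidiag_rot i x).2 == rev_ord (antidiag_rot i x).1) = (x.2 == rev_ord x.1).
Proof.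
rewrite /antidiag_rot; case: ifP => //= /eqP e.
by rewrite e iter_half_rot_rev eqxx.
Qed.

Lemma antidiag_rot_inj n i : injective (@antidiag_rot n i).
Proof.
move=> x y e; have := antidiag_rot_rev i x; rewrite e antidiag_rot_rev; move: e.
rewrite /antidiag_rot; case: x y => [r c] [r' c'] /= + ec.
rewrite ec; case: ifP => // _.
by move=> [] /iter_half_rot_inj-> /iter_half_rot_inj->.
Qed.

Lemma antidiag_rot_swap n i (x : 'I_(n + n) * 'I_(n + n)) :
  antidiag_rot i (x.2, x.1) = ((antidiag_rot i x).2, (antidiag_rot i x).1).
Proof. by rewrite /antidiag_rot /= eq_rev_ord; case: ifP. Qed.

Lemma antidiag_rot_diag n i (x : 'I_(n + n) * 'I_(n + n)) :
  ((antidiag_rot i x).1 == (antidiag_rot i x).2) = (x.1 == x.2).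
Proof.
by rewrite /antidiag_rot; case: ifP => //= _; rewrite (inj_eq (@iter_half_rot_inj n i)).
Qed.

Lemma T_rot_cells n i s :
  #|cells s (iter i (@piAD2 n) (T_array n))| = #|cells s (T_array n)|.
Proof.
rewrite -(card_preimset (cells s (T_array n)) (@antidiag_rot_inj n i)).
by apply: eq_card => -[r c]; rewrite !inE iter_piAD2E.
Qed.

Lemma T_rot_occurs n i s :
  occurs s (iter i (@piAD2 n) (T_array n)) -> occurs s (T_array n).
Proof. by move=> /occursP[[r c] /=]; rewrite iter_piAD2E => /occurs_at. Qed.

Lemma T_rot_star n i (r c : 'I_(n + n)) :
  (iter i (@piAD2 n) (T_array n) r c == None) = (r == c).
Proof. by rewrite iter_piAD2E T_array_star antidiag_rot_diag. Qed.

(** * Off-diagonal blocks, and $P_\ast^{(n)}$ as a regular PDA *)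

Lemma antidiag_arrayE m t (i j : 'I_m) :
  antidiag_array m t i j = if j == rev_ord i then Some t else None.
Proof. by rewrite mxE antidiag_rev. Qed.

Lemma antidiag_array_occurs m s t : occurs s (antidiag_array m t) -> s = t.
Proof. by move=> /occursP[[i j]]; rewrite antidiag_arrayE; case: ifP => // _ []. Qed.

Lemma antidiag_array_cells m t : #|cells t (antidiag_array m t)| = m.
Proof.
rewrite -[RHS]card_ord -(card_imset _ (f := fun i : 'I_m => (i, rev_ord i))).
  apply: eq_card => -[i j]; rewrite !inE antidiag_arrayE; apply/eqP/imsetP.
    by case: eqP => //= -> _; exists i.
  by move=> [k _ [-> ->]]; rewrite eqxx.
by move=> i j [].
Qed.

(** The conclusion says that the mixed cells avoid the antidiagonal, so they are stars in the
    off-diagonal blocks. Equal integers mean that the rotated cells coincide or are transposes of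
    each other. *)
Lemma T_rot_Blackburn n i i' (x y : 'I_(n + n) * 'I_(n + n)) s :
    i < n -> i' < n -> i != i' ->
    iter i (@piAD2 n) (T_array n) x.1 x.2 = Some s ->
    iter i' (@piAD2 n) (T_array n) y.1 y.2 = Some s ->
  (y.2 != rev_ord x.1) && (x.2 != rev_ord y.1).
Proof.
move=> lti lti' /eqP neq; rewrite !iter_piAD2E -!surjective_pairing => e e'.
have eyx := T_array_inj e e'.
have ec : (y.2 == rev_ord y.1) = (x.2 == rev_ord x.1).
  rewrite -(antidiag_rot_rev i x) -(antidiag_rot_rev i').
  by case: eyx => -> //=; rewrite eq_rev_ord.
move: eyx ec {e e'}; case: x y => [r c] [r' c']; rewrite /antidiag_rot /= => + ec.
rewrite ec; case: (c =P rev_ord r) ec => [-> /idP/eqP->|/eqP nc _].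
  (* Both cells are antidiagonal, so a mixed cell is antidiagonal only if the rows agree. Then
     either two powers of the rotation agree at [r], forcing equal exponents, or one sends [r] where
     another sends its reversal. *)
  have [<-|ner _] := eqVneq r r'.
    by case=> -[e _]; case: neq; [apply/esym/(iter_half_rot_free _ _ e)
      | case: (iter_half_rot_neq_rev e)].
  by rewrite !(inj_eq rev_ord_inj) eq_sym ner.
(* Off the antidiagonal nothing moves: the mixed cells are the cell itself, or diagonal cells, which
   miss the antidiagonal as the size is even. *)
by case=> -[-> ->]; rewrite ?nc // !rev_ord_double_neq.
Qed.

(** A column has one star in its diagonal block and $2n-1$ in each of the $n-1$ others. An integer
    of $T$ occurs twice in each of the [n] diagonal blocks, and each $t_{i,j}$ fills one
    antidiagonal of length $2n$. *)
Lemma Pstar_gpda n (t : 'I_n -> 'I_n -> int) :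
    (forall i j k l : 'I_n, i != j -> k != l -> t i j = t k l -> i = k /\ j = l) ->
    (forall i j : 'I_n, i != j -> ~~ occurs (t i j) (T_array n)) ->
  gpda_axioms (2 * n) (1 + n.-1 * (n + n).-1) (Pstar_array t).
Proof.
move=> t_inj t_T; split.
- move=> y; case: (mxtens_indexP y) => b c.
  rewrite block_array_stars (bigD1 b) //= eqxx; congr (_ + _).
    by apply/eqP/cards1P; exists c; apply/setP => r; rewrite !inE T_rot_star.
  rewrite (eq_bigr (fun=> (n + n).-1)) => [|a /negPf->].
    by rewrite sum_nat_const cardC1 card_ord.
  rewrite -[in RHS](card_ord (n + n)) -(cardC1 (rev_ord c)).
  apply: eq_card => r; rewrite !inE antidiag_arrayE eq_rev_ord.
  by case: (r == _).
- move=> x1 y1 x2 y2 s.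
  case: (mxtens_indexP x1) => i1 r1; case: (mxtens_indexP y1) => j1 c1.
  case: (mxtens_indexP x2) => i2 r2; case: (mxtens_indexP y2) => j2 c2.
  rewrite !block_arrayE => ne.
  case: (eqVneq i1 j1) => [ej1|nej1]; case: (eqVneq i2 j2) => [ej2|nej2] e1 e2.
  + subst j1 j2; rewrite [i2 == _]eq_sym; case: (eqVneq i1 i2) => [ei|nei].
      subst i2; move: e1 e2; rewrite !iter_piAD2E => e1 e2.
      have [/antidiag_rot_inj[er ec]|e] := T_array_inj e1 e2.
        by rewrite er ec eqxx in ne.
      (* Transposed cells in one diagonal block: their mixed cells lie on the diagonal, where the
         stars are. *)
      move: e; rewrite -antidiag_rot_swap => /antidiag_rot_inj[-> ->] /=.
      by split; apply/eqP; rewrite T_array_star antidiag_rot_diag.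
    have /andP[] := T_rot_Blackburn (x := (r1, c1)) (y := (r2, c2))
      (ltn_ord i1) (ltn_ord i2) nei e1 e2.
    by rewrite !antidiag_arrayE /= => /negPf-> /negPf->.
  + have /negP[] := t_T _ _ nej2.
    by rewrite -(antidiag_array_occurs (occurs_at e2)); apply/T_rot_occurs/(occurs_at e1).
  + have /negP[] := t_T _ _ nej1.
    by rewrite -(antidiag_array_occurs (occurs_at e1)); apply/T_rot_occurs/(occurs_at e2).
  + have [ei ej] : i1 = i2 /\ j1 = j2.
      apply: t_inj => //; rewrite -(antidiag_array_occurs (occurs_at e1)).
      exact: antidiag_array_occurs (occurs_at e2).
    subst i2 j2; rewrite (negPf nej1); move: e1 e2 ne; rewrite !antidiag_arrayE.
    case: eqP => // -> _; case: eqP => // -> _ ne.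
    rewrite !(inj_eq rev_ord_inj) [r1 == r2]eq_sym.
    by case: eqP => // er; rewrite er eqxx in ne.
- move=> s /block_array_occurs[a [b]]; rewrite block_array_cells.
  case: (eqVneq a b) => [_ /T_rot_occurs occ|neab /antidiag_array_occurs es].
    rewrite (eq_bigr (fun=> 2)) => [|c _]; first by rewrite sum_nat_const card_ord mulnC.
    rewrite (bigD1 c) //= eqxx T_rot_cells T_array_cells // big1 // => d ne.
    rewrite eq_sym in ne; rewrite (negPf ne) cells_notin //.
    by apply/negP => /antidiag_array_occurs es; have /negP[] := t_T _ _ ne; rewrite -es.
  rewrite pair_bigA /= (bigD1 (a, b)) //= (negPf neab) big1 => [|[c d] /= ne].
    by rewrite es antidiag_array_cells addn0 mul2n addnn.
  case: (eqVneq c d) => [_|necd]; apply: cells_notin; apply/negP.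
    by move=> /T_rot_occurs; apply/negP; rewrite es t_T.
  move=> /antidiag_array_occurs; rewrite es => /(t_inj _ _ _ _ neab necd)[ea eb].
  by rewrite ea eb eqxx in ne.
Qed.

(* 4n^3 - 8n^2 + 7n - 2 and 8n^2 - 7n + 2 are written with a single truncated
   subtraction, which is exact for n >= 1. *)
Theorem lemma20 (n : nat) (n_ge1 : 1 <= n) (t : 'I_n -> 'I_n -> int)
  (t_distinct : forall i j k l : 'I_n, i != j -> k != l ->
     t i j = t k l -> i = k /\ j = l)
  (t_notin_T : forall i j : 'I_n, i != j -> ~~ occurs (t i j) (T_array n)) :
  exists P : 'I_(2 * n) -> 'Arr_(n * (n + n), n * (n + n)),
    [/\ injective P,
        forall a, is_gpda 1 (2 * n ^ 2) (2 * n ^ 2) 0 (4 * n ^ 4) (P a),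
        family_compatible P (Pstar_array t),
        (exists rho, admissible_relabelling P (Pstar_array t) rho)
      & forall rho, admissible_relabelling P (Pstar_array t) rho ->
          is_gpda (2 * n) (4 * n ^ 3) (4 * n ^ 3)
            ((4 * n ^ 3 + 7 * n) - (8 * n ^ 2 + 2))
            (2 * n ^ 2 * (8 * n ^ 2 + 2 - 7 * n))
            (lifting_I P (Pstar_array t) rho)].
Proof.
have Pstar := Pstar_gpda t_distinct t_notin_T.
have occ : exists s, occurs s (Pstar_array t).
  (* Both [a] and [r] are 0: the top right corner of the first diagonal block is off the diagonal,
     so it holds an integer. *)
  pose a := Ordinal n_ge1; pose r : 'I_(n + n) := Ordinal (ltn_addl n n_ge1).
  have := T_rot_star a r (rev_ord r); rewrite (negPf (rev_ord_double_neq r)).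
  case e: (fun_of_matrix _ _ _) => [s|] // _; exists s; apply/block_array_occurs; exists a, a.
  by rewrite eqxx; apply: occurs_at e.
have [P [Pinj Ppda Pcomp Pocc Pnat]] := nonneg_label_family Pstar occ.
have n0 : 0 < n * (n + n) by rewrite muln_gt0 addn_gt0 n_ge1.
exists P; split => //.
- move=> a; have -> : 2 * n ^ 2 = n * (n + n) by rewrite -mulnn; lia.
  apply: gpda_axioms_is_gpda => //.
  by rewrite muln0 addn0 mul1n !expnS expn0; lia.
- exact: admissible_relabelling_exists.
- move=> rho /(lifting_gpda Pstar Pinj Ppda Pcomp Pocc).
  have -> : 4 * n ^ 3 = 2 * n * (n * (n + n)) by rewrite !expnS expn0; lia.
  have eZ : (2 * n).-1 * (1 + n.-1 * (n + n).-1) =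
      2 * n * (n * (n + n)) + 7 * n - (8 * n ^ 2 + 2).
    by clear -n_ge1; case: n n_ge1 => // m _; rewrite !expnS expn0; nia.
  rewrite eZ => L; apply: gpda_axioms_is_gpda L; rewrite ?muln_gt0 ?addn_gt0 ?n_ge1 //.
  rewrite -eZ.
  (* Writing [n] as [m.+1] turns $8n^2-7n+2$ into $8m^2+9m+3$, which removes the truncated
     subtraction before [ring]. *)
  clear -n_ge1; case: n n_ge1 => // m _; rewrite (_ : _ + 2 - _ = 8 * m ^ 2 + 9 * m + 3).
    have -> : (2 * m.+1).-1 = 2 * m + 1 by lia.
    have -> : (m.+1 + m.+1).-1 = 2 * m + 1 by lia.
    by rewrite succnK; ring.
  by rewrite !expnS expn0; lia.
Qed.
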